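(* Let $F$ be a field and let $m(x)=x^3+ax^2+bx+c\in F[x]$ be irreducible. Let $A,B,C\in\mathcal{C}(m)$ be distinct and such that both $B-A$ and $C-A$ are singular. Then the following are equivalent. (i) $\mathcal{V}(A,B,C)$ is not invertible. (ii) The $6\times 6$ matrix $\mathcal{V}_2:=\begin{bmatrix} B-A & C-A\\ B^2-A^2 & C^2-A^2\end{bmatrix}$ is not invertible. (iii) $\mathfrak{N}_{AB}=\mathfrak{N}_{AC}$. (iv) $\mathfrak{n}(B-A)=\mathfrak{n}(C-A)$. (v) There exists a nonzero $v\in F^3$ such that $vA=vB=vC$.
   Context: $M_3(F)$ is the ring of $3\times 3$ matrices over $F$, and $F^3$ is the space of row vectors. $\mathcal{C}(m)$ is the set of all $A\in M_3(F)$ whose minimal polynomial is $m$. $\mathcal{V}(A,B,C)$ denotes the $9\times 9$ block Vandermonde matrix $\begin{bmatrix} I&I&I\\ A&B&C\\ A^2&B^2&C^2\end{bmatrix}$, where $I$ is the $3\times 3$ identity matrix. For $X\in M_3(F)$, $\mathfrak{n}(X)=\{v\in F^3: vX=0\}$ is the left nullspace of $X$. For $A,B\in\mathcal{C}(m)$, $\mathfrak{N}_{AB}:=\mathfrak{n}(B-A)\oplus\mathfrak{n}(B^2-A^2)$, the sum of these subspaces inside $F^3$ (and similarly $\mathfrak{N}_{AC}$). *)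

(* Defs.v *)
From mathcomp Require Import all_boot all_order all_algebra.

Set Implicit Arguments.
Unset Strict Implicit.
Unset Printing Implicit Defensive.

Import GRing.Theory.
Local Open Scope ring_scope.

Definition minpoly_class (F : fieldType) (m : {poly F}) : {pred 'M[F]_3} :=
  [pred A | mxminpoly A == m].

Definition block_vandermonde3 (F : fieldType) (A B C : 'M[F]_3) :
    'M[F]_(3 + (3 + 3)) :=
  col_mx (row_mx 1%:M (row_mx 1%:M 1%:M))
 (col_mx (row_mx A (row_mx B C))
         (row_mx (A ^+ 2) (row_mx (B ^+ 2) (C ^+ 2)))).

Definition vandermonde_diff2 (F : fieldType) (A B C : 'M[F]_3) :
    'M[F]_(3 + 3) :=
  block_mx (B - A)           (C - A)
           (B ^+ 2 - A ^+ 2) (C ^+ 2 - A ^+ 2).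

(* Subspaces of F^3 are represented by row spaces; kermx X spans the left
   nullspace {v | v *m X = 0}.  For distinct A and B with the same irreducible
   cubic minimal polynomial the two summands meet trivially, so that this sum
   is the internal direct sum. *)
Definition null_sum (F : fieldType) (A B : 'M[F]_3) : 'M[F]_3 :=
  (kermx (B - A)%R + kermx (B ^+ 2 - A ^+ 2)%R)%MS.

(* Main.v *)
(** Right multiplication by A makes F^3 a line over the cubic field F[x]/(m).
If e spans n(B - A), then n(B^2 - A^2) is spanned by e(A + a), and the left
kernel of the stacked matrix [B - A; B^2 - A^2] is exactly
{(e(x - yA), e(y + z(A + a))) : x, y, z in F}: these rows form a
3-dimensional subspace, and the stacked matrix has rank 3 because the
right-hand analogue of n(B - A) and n(B^2 - A^2) meeting trivially holds.
V_2 is singular iff the two such kernels attached to (B, e) and (C, e') share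
a nonzero row.  Eliminating the ratio e'/e gives
(x - yA)(y' + z'(A + a)) = (x' - y'A)(y + z(A + a)); comparing coefficients of
1, A, A^2 makes (x, y, z) and (x', y', z') proportional over F, so e' is an
F-multiple of e.  Finally N_AB = <e, eA>, which determines the line <e>. *)
Require Import Defs.
From mathcomp Require Import all_boot all_order all_algebra.
From mathcomp Require Import ring.

Set Implicit Arguments.
Unset Strict Implicit.
Unset Printing Implicit Defensive.

Import GRing.Theory.
Local Open Scope ring_scope.

(** * Rows acted on by polynomials in a matrix with irreducible annihilator *)

Lemma singular_row_kernel (F : fieldType) (n : nat) (M : 'M[F]_n) :
  M \notin unitmx <-> exists2 v : 'rV_n, v != 0 & v *m M = 0.
Proof.
rewrite -row_free_unit -kermx_eq0; split=> [/rowV0Pn[v /sub_kermxP]|[v v0 vM]].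
  by exists v.
by apply/rowV0Pn; exists v => //; apply/sub_kermxP.
Qed.

(** A nonzero [p] would be coprime to [m] by irreducibility and the degree bound; a Bezout relation
    evaluated at [A] then makes [horner_mx A p] invertible, against [v != 0]. *)
Lemma horner_mx_annihilated (F : fieldType) (n : nat) (A : 'M[F]_n.+1)
    (m p : {poly F}) (v : 'rV_n.+1) :
    irreducible_poly m -> horner_mx A m = 0 -> (size p < size m)%N ->
  v != 0 -> v *m horner_mx A p = 0 -> p = 0.
Proof.
move=> m_irr mA0 lt_pm v0 vp0; apply: contra_neq_eq v0 => p0.
have /Bezout_eq1_coprimepP[u uE] : coprimep m p.
  rewrite irreducible_poly_coprime //; apply/negP => /(dvdp_leq p0).
  by rewrite leqNgt lt_pm.
have := congr1 (fun q => v *m horner_mx A q) uE.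
rewrite /= rmorph1 mulmx1 mulrC rmorphD !rmorphM /= mA0 mul0r add0r => <-.
rewrite -rmorphM mulrC rmorphM.
by rewrite -mulmxE mulmxA vp0 mul0mx.
Qed.

(** A row [u] killing the Krylov matrix is a polynomial [rVpoly u] of degree at most n whose value
    at [A] kills [v], hence zero. *)
Lemma krylov_unitmx (F : fieldType) (n : nat) (A : 'M[F]_n.+1)
    (m : {poly F}) (v : 'rV_n.+1) :
    irreducible_poly m -> horner_mx A m = 0 -> (n.+1 < size m)%N -> v != 0 ->
  \matrix_(i < n.+1) (v *m A ^+ i) \in unitmx.
Proof.
move=> m_irr mA0 lt_nm v0; apply/negPn/negP => /singular_row_kernel[u u0 uK].
case/eqP: u0; rewrite -[u]rVpolyK.
rewrite (@horner_mx_annihilated _ _ _ _ (rVpoly u) _ m_irr mA0 _ v0)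
  ?linear0 //.
  exact: leq_ltn_trans (size_poly _ _) lt_nm.
rewrite -uK [RHS]mulmx_sum_row [rVpoly u]poly_def rmorph_sum /= mulmx_sumr.
apply: eq_bigr => i _; rewrite rowK valK /= linearZ /= rmorphXn /= horner_mx_X.
by rewrite -scalemxAr.
Qed.

(** * The cubic case: coordinates with respect to e, eA, eA^2 *)

Definition cubic (F : fieldType) (a b c : F) : {poly F} :=
  'X^3 + a *: 'X^2 + b *: 'X + c%:P.

Lemma size_cubic (F : fieldType) (a b c : F) : size (cubic a b c) = 4.
Proof.
rewrite /cubic -!addrA size_polyDl ?size_polyXn //.
rewrite -mul_polyC -mul_polyC ltnS; apply/leq_sizeP => j j3.
by rewrite !coefD !coefCM coefXn coefX coefC; case: j j3 => [|[|[|j]]] //= _;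
  rewrite !mulr0 !addr0.
Qed.

Lemma horner_mx_cubic (F : fieldType) (a b c : F) (A : 'M[F]_3) :
  horner_mx A (cubic a b c) = A ^+ 3 + a *: A ^+ 2 + b *: A + c%:M.
Proof.
by rewrite /cubic !rmorphD /= !linearZ /= !rmorphXn /= horner_mx_X horner_mx_C.
Qed.

Lemma mul_row_cubic (F : fieldType) (a b c : F) (A : 'M[F]_3) (v : 'rV_3) :
    horner_mx A (cubic a b c) = 0 ->
  v *m A *m A *m A = - (a *: (v *m A *m A) + b *: (v *m A) + c *: v).
Proof.
move=> A0; apply/eqP; rewrite -addr_eq0 !addrA; apply/eqP.
transitivity (v *m horner_mx A (cubic a b c)); last by rewrite A0 mulmx0.
rewrite horner_mx_cubic !mulmxDr -!scalemxAr !exprS expr0 mulr1 -!mulmxE.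
by rewrite !mulmxA mul_mx_scalar.
Qed.

(** Carries results on rows over to columns by transposition. *)
Lemma horner_mx_cubic_tr (F : fieldType) (a b c : F) (A : 'M[F]_3) :
  horner_mx A (cubic a b c) = 0 -> horner_mx A^T (cubic a b c) = 0.
Proof.
rewrite !horner_mx_cubic => /(congr1 trmx); rewrite trmx0 => <-.
by rewrite !linearD !linearZ /= tr_scalar_mx !exprS expr0 !mulr1 -!mulmxE
  !trmx_mul mulmxA.
Qed.

Lemma cubic_coords_eq0 (F : fieldType) (a b c x y z : F) (A : 'M[F]_3)
    (e : 'rV_3) :
    irreducible_poly (cubic a b c) -> horner_mx A (cubic a b c) = 0 ->
    e != 0 -> x *: e + y *: (e *m A) + z *: (e *m A *m A) = 0 ->
  [/\ x = 0, y = 0 & z = 0].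
Proof.
move=> m_irr A0 e0 xyz0; pose p := \poly_(i < 3) [:: x; y; z]`_i.
have p0 : p = 0.
  apply: (horner_mx_annihilated m_irr A0 _ e0).
    by rewrite size_cubic ltnS size_poly.
  rewrite -xyz0 [p]poly_def !big_ord_recl big_ord0 /= addr0 addrA.
  rewrite !rmorphD /= !linearZ /= !rmorphXn /= horner_mx_X expr0 !mulmxDr.
  by rewrite -!scalemxAr mulmx1 expr1 expr2 -mulmxE mulmxA.
have p_coef i : (i < 3)%N -> [:: x; y; z]`_i = 0.
  by move=> i3; have := congr1 (fun q : {poly F} => q`_i) p0;
    rewrite /= coef_poly i3 coef0.
by split; [exact: (p_coef 0) | exact: (p_coef 1) | exact: (p_coef 2)].
Qed.

Lemma lin_coords_eq0 (F : fieldType) (a b c x y : F) (A : 'M[F]_3)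
    (e : 'rV_3) :
    irreducible_poly (cubic a b c) -> horner_mx A (cubic a b c) = 0 ->
    e != 0 -> x *: e - y *: (e *m A) = 0 ->
  x = 0 /\ y = 0.
Proof.
move=> m_irr A0 e0 xy0.
have [] : [/\ x = 0, - y = 0 & 0 = 0 :> F].
  by apply: (cubic_coords_eq0 m_irr A0 e0); rewrite scale0r addr0 scaleNr.
by move=> -> /eqP; rewrite oppr_eq0 => /eqP->.
Qed.

Lemma affine_coords_eq0 (F : fieldType) (a b c y z : F) (A : 'M[F]_3)
    (e : 'rV_3) :
    irreducible_poly (cubic a b c) -> horner_mx A (cubic a b c) = 0 ->
    e != 0 -> y *: e + z *: (e *m A + a *: e) = 0 ->
  y = 0 /\ z = 0.
Proof.
move=> m_irr A0 e0 yz0.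
have [] : [/\ y + z * a = 0, z = 0 & 0 = 0 :> F].
  apply: (cubic_coords_eq0 m_irr A0 e0); rewrite scale0r addr0 scalerDl.
  by rewrite -scalerA -addrA (addrC (_ *: (a *: e))) -scalerDr.
by move=> + z0 _; rewrite z0 mul0r addr0 => ->.
Qed.

(* A and B then agree on the Krylov basis v, vA, vA^2. *)
Lemma cubic_eq_rows (F : fieldType) (a b c : F) (A B : 'M[F]_3) (v : 'rV_3) :
    irreducible_poly (cubic a b c) ->
    horner_mx A (cubic a b c) = 0 -> horner_mx B (cubic a b c) = 0 ->
    v != 0 -> v *m A = v *m B -> v *m A *m A = v *m B *m B ->
  A = B.
Proof.
move=> m_irr A0 B0 v0 v1 v2.
(* Agreement on the last Krylov row: the cubic relation rewrites vA^3 and vB^3 as the same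
   combination of lower powers. *)
have vAA : v *m A *m A *m A = v *m A *m A *m B.
  by rewrite (mul_row_cubic v A0) v2 (mul_row_cubic v B0) v1.
have K_unit := krylov_unitmx m_irr A0 _ v0.
rewrite size_cubic in K_unit; have {}K_unit := K_unit isT.
apply: (can_inj (mulKmx K_unit)); apply/row_matrixP => i.
rewrite !row_mul !rowK; case: i => [[|[|[|//]]] ?] /=.
- by rewrite expr0 mulmx1.
- by rewrite expr1 v2 v1.
- by rewrite expr2 -mulmxE !mulmxA.
Qed.

(** * The left kernel of the stacked matrix [B - A; B^2 - A^2] *)

Lemma sub_sqr_mulmx (F : fieldType) (A B : 'M[F]_3) (v : 'rV_3) :
  v *m (B ^+ 2 - A ^+ 2) = v *m B *m B - v *m A *m A.
Proof. by rewrite !expr2 -!mulmxE mulmxBr !mulmxA. Qed.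

(** By the cubic relation e(A + a)A^2 = -(b eA + c e), which involves only e and eA = eB, so B gives
    the same value. *)
Lemma mul_shift_diff_sqr (F : fieldType) (a b c : F) (A B : 'M[F]_3)
    (e : 'rV_3) :
    horner_mx A (cubic a b c) = 0 -> horner_mx B (cubic a b c) = 0 ->
    e *m A = e *m B ->
  (e *m A + a *: e) *m (B ^+ 2 - A ^+ 2) = 0.
Proof.
move=> A0 B0 eAB; rewrite sub_sqr_mulmx !mulmxDl -!scalemxAl.
have := mul_row_cubic e B0; rewrite -eAB (mul_row_cubic e A0) => ->.
have cancel3 (p q r : 'rV[F]_3) : - (p + q + r) + p = - (q + r).
  by rewrite -addrA opprD addrAC addNr add0r.
by rewrite !cancel3 subrr.
Qed.

(* Transposition turns a column killed by both blocks into a row on which A^T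
and B^T agree together with their squares. *)
Lemma rank_diff_col (F : fieldType) (a b c : F) (A B : 'M[F]_3) :
    irreducible_poly (cubic a b c) ->
    horner_mx A (cubic a b c) = 0 -> horner_mx B (cubic a b c) = 0 -> A != B ->
  \rank (col_mx (B - A) (B ^+ 2 - A ^+ 2)) = 3.
Proof.
move=> m_irr A0 B0 neqAB; rewrite -mxrank_tr; apply/eqP.
rewrite -[_ == _]/(row_free _) -kermx_eq0; apply/rowV0P => y /sub_kermxP.
rewrite tr_col_mx mul_mx_row -[0]row_mx0 => /eq_row_mx[].
have -> : (B ^+ 2 - A ^+ 2)^T = B^T ^+ 2 - A^T ^+ 2.
  by rewrite linearB /= !expr2 -!mulmxE !trmx_mul.
rewrite sub_sqr_mulmx linearB /= mulmxBr => /eqP; rewrite subr_eq0 => /eqP y1.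
move=> /eqP; rewrite subr_eq0 => /eqP y2.
apply/eqP; apply: contraNT neqAB => y0; apply/eqP/trmx_inj.
by apply: (cubic_eq_rows m_irr _ _ y0); rewrite // ?horner_mx_cubic_tr.
Qed.

Lemma diff_col_kernel (F : fieldType) (a b c : F) (A B : 'M[F]_3)
    (e v w : 'rV_3) :
    irreducible_poly (cubic a b c) ->
    horner_mx A (cubic a b c) = 0 -> horner_mx B (cubic a b c) = 0 -> A != B ->
    e != 0 -> e *m A = e *m B ->
    v *m (B - A) + w *m (B ^+ 2 - A ^+ 2) = 0 ->
  exists x y z : F,
    v = x *: e - y *: (e *m A) /\ w = y *: e + z *: (e *m A + a *: e).
Proof.
move=> m_irr A0 B0 neqAB e0 eAB vw0.
set M := col_mx (B - A) (B ^+ 2 - A ^+ 2).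
(* The rows of [N] are the generators of the claimed family, with coefficients x, y, z. The middle
   one is killed because eAB = eB^2. *)
pose N : 'M[F]_(1 + (1 + 1), 3 + 3) := col_mx (row_mx e 0)
  (col_mx (row_mx (- (e *m A)) e) (row_mx 0 (e *m A + a *: e))).
have NM : N *m M = 0.
  rewrite !mul_col_mx !mul_row_col !mul0mx addr0 add0r.
  rewrite (mul_shift_diff_sqr A0 B0 eAB) sub_sqr_mulmx mulNmx !mulmxBr -eAB.
  by rewrite subrr addNr !col_mx0.
have N_free : row_free N.
  rewrite -kermx_eq0; apply/rowV0P => u /sub_kermxP.
  rewrite -[u]hsubmxK -[rsubmx u]hsubmxK !mul_row_col.
  rewrite [lsubmx u]mx11_scalar [lsubmx (rsubmx u)]mx11_scalar.
  rewrite [rsubmx (rsubmx u)]mx11_scalar !mul_scalar_mx !scale_row_mx.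
  rewrite !add_row_mx; set x := lsubmx u 0 0; set y := lsubmx (rsubmx u) 0 0.
  set z := rsubmx (rsubmx u) 0 0.
  move=> /eqP; rewrite row_mx_eq0 !scaler0 add0r addr0 scalerN.
  case/andP=> /eqP/(lin_coords_eq0 m_irr A0 e0)[x0 y0].
  case/eqP/(affine_coords_eq0 m_irr A0 e0) => _ z0.
  by rewrite x0 y0 z0 !raddf0 !row_mx0.
have : (row_mx v w <= N)%MS.
  (* [N] has rank 3 and the kernel has dimension 6 - 3, so the inclusion is an equality. *)
  have NK : (N <= kermx M)%MS by apply/sub_kermxP.
  have := geq_leqif (mxrank_leqif_eq NK).
  rewrite mxrank_ker (rank_diff_col m_irr) // (eqP N_free) => /esym/eqmxP->.
  by apply/sub_kermxP; rewrite mul_row_col.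
case/submxP => D; rewrite -[D]hsubmxK -[rsubmx D]hsubmxK.
set x := lsubmx D; set y := lsubmx (rsubmx D); set z := rsubmx (rsubmx D).
rewrite !mul_row_col [x]mx11_scalar [y]mx11_scalar [z]mx11_scalar.
rewrite !mul_scalar_mx !scale_row_mx !add_row_mx !scaler0 add0r addr0 scalerN.
by case/eq_row_mx => -> ->; exists (x 0 0), (y 0 0), (z 0 0).
Qed.

(** * The nullspaces n(B - A), n(B^2 - A^2) and their sum *)

(** The kernel rows with w = 0: this forces y = 0 and leaves v = xe. *)
Lemma kermx_diff (F : fieldType) (a b c : F) (A B : 'M[F]_3) (e : 'rV_3) :
    irreducible_poly (cubic a b c) ->
    horner_mx A (cubic a b c) = 0 -> horner_mx B (cubic a b c) = 0 -> A != B ->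
    e != 0 -> e *m A = e *m B ->
  (kermx (B - A)%R :=: e)%MS.
Proof.
move=> m_irr A0 B0 neqAB e0 eAB; apply/eqmxP/andP; split; last first.
  by apply/sub_kermxP; rewrite mulmxBr eAB subrr.
apply/rV_subP => v /sub_kermxP vK.
have [|x [y [z [-> /esym]]]] :=
  @diff_col_kernel _ _ _ _ _ _ _ v 0 m_irr A0 B0 neqAB e0 eAB.
  by rewrite vK mul0mx addr0.
case/(affine_coords_eq0 m_irr A0 e0) => -> _.
by rewrite scale0r subr0 scalemx_sub.
Qed.

(** The kernel rows with v = 0: this forces y = 0 and leaves w = ze(A + a). *)
Lemma kermx_diff_sqr (F : fieldType) (a b c : F) (A B : 'M[F]_3)
    (e : 'rV_3) :
    irreducible_poly (cubic a b c) ->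
    horner_mx A (cubic a b c) = 0 -> horner_mx B (cubic a b c) = 0 -> A != B ->
    e != 0 -> e *m A = e *m B ->
  (kermx (B ^+ 2 - A ^+ 2)%R :=: (e *m A + a *: e)%R)%MS.
Proof.
move=> m_irr A0 B0 neqAB e0 eAB; apply/eqmxP/andP; split; last first.
  by apply/sub_kermxP; exact: mul_shift_diff_sqr A0 B0 eAB.
apply/rV_subP => w /sub_kermxP wK.
have [|x [y [z [/esym + ->]]]] :=
  @diff_col_kernel _ _ _ _ _ _ _ 0 w m_irr A0 B0 neqAB e0 eAB.
  by rewrite wK mul0mx addr0.
case/(lin_coords_eq0 m_irr A0 e0) => _ ->.
by rewrite scale0r add0r scalemx_sub.
Qed.

Lemma null_sum_span (F : fieldType) (a b c : F) (A B : 'M[F]_3) (e : 'rV_3) :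
    irreducible_poly (cubic a b c) ->
    horner_mx A (cubic a b c) = 0 -> horner_mx B (cubic a b c) = 0 -> A != B ->
    e != 0 -> e *m A = e *m B ->
  (null_sum A B :=: e + e *m A)%MS.
Proof.
move=> m_irr A0 B0 neqAB e0 eAB; rewrite /null_sum.
apply: eqmx_trans (adds_eqmx (kermx_diff m_irr A0 B0 neqAB e0 eAB)
  (kermx_diff_sqr m_irr A0 B0 neqAB e0 eAB)) _.
apply/eqmxP/andP; split; rewrite addsmx_sub addsmxSl /=.
  by rewrite addmx_sub ?addsmxSr // scalemx_sub // addsmxSl.
rewrite -[X in (X <= _)%MS](addrK (a *: e)).
by rewrite addmx_sub ?addsmxSr // eqmx_opp scalemx_sub // addsmxSl.
Qed.

(** If e' = xe + yeA, then e'A has coefficient y on eA^2, which is independent of e and eA; so y =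
    0. *)
Lemma span_shift_parallel (F : fieldType) (a b c : F) (A : 'M[F]_3)
    (e e' : 'rV_3) :
    irreducible_poly (cubic a b c) -> horner_mx A (cubic a b c) = 0 ->
    e != 0 -> (e' <= e + e *m A)%MS -> (e' *m A <= e + e *m A)%MS ->
  exists t : F, e' = t *: e.
Proof.
move=> m_irr A0 e0 /sub_addsmxP[[p q] /=].
rewrite [p]mx11_scalar [q]mx11_scalar !mul_scalar_mx => ->.
case/sub_addsmxP => -[r s] /=.
rewrite [r]mx11_scalar [s]mx11_scalar !mul_scalar_mx mulmxDl -!scalemxAl.
set x := p 0 0; set y := q 0 0; set z := r 0 0; set t := s 0 0 => eq_xy.
have [] : [/\ - z = 0, x - t = 0 & y = 0].
  apply: (cubic_coords_eq0 m_irr A0 e0); rewrite scalerBl scaleNr.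
  by rewrite -!addrA addrCA [- _ + _]addrA -opprD addrCA eq_xy addNr.
by move=> _ _ ->; exists x; rewrite scale0r addr0.
Qed.

(** * Comparison of the kernels attached to B and to C *)

Lemma mul_horner_quadratic (F : fieldType) (x y z : F) (A : 'M[F]_3)
    (e : 'rV_3) :
  e *m horner_mx A (x%:P + y%:P * 'X + z%:P * 'X^2) =
  x *: e + y *: (e *m A) + z *: (e *m A *m A).
Proof.
rewrite !mul_polyC !rmorphD /= !linearZ /= rmorphXn /= horner_mx_C horner_mx_X.
by rewrite !mulmxDr mul_mx_scalar -!scalemxAr expr2 -mulmxE mulmxA.
Qed.

(** The 2 x 2 minors of two triples vanish and the second triple is nonzero; t is the quotient at
    its first nonzero entry. *)
Lemma proportional3 (F : fieldType) (x y z x' y' z' : F) :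
    x * y' = x' * y -> x * z' = x' * z -> y * z' = y' * z ->
    ~ [/\ x' = 0, y' = 0 & z' = 0] ->
  exists t : F, [/\ x = t * x', y = t * y' & z = t * z'].
Proof.
move=> xy xz yz nz'.
have [x'0|x'0] := eqVneq x' 0; last first.
  exists (x / x'); split; first by rewrite divfK.
    by apply: (mulfI x'0); rewrite mulrA (mulrC x' (_ / _)) divfK.
  by apply: (mulfI x'0); rewrite mulrA (mulrC x' (_ / _)) divfK.
have {xy} xy : x * y' = 0 by rewrite xy x'0 mul0r.
have {xz} xz : x * z' = 0 by rewrite xz x'0 mul0r.
have x0 : x = 0.
  apply/eqP; apply: contra_notT nz' => x0; split=> //; apply: (mulfI x0).
    by rewrite xy mulr0.
  by rewrite xz mulr0.
have [y'0|y'0] := eqVneq y' 0; last first.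
  exists (y / y'); rewrite x0 x'0 mulr0 divfK //; split=> //.
  by rewrite mulrAC yz mulrAC divff // mul1r.
have z'0 : z' != 0 by apply/eqP => z'0; case: nz'.
exists (z / z'); rewrite x0 x'0 y'0 !mulr0 divfK //; split=> //.
by apply: (mulIf z'0); rewrite yz y'0 !mul0r.
Qed.

Lemma kernels_parallel (F : fieldType) (a b c : F) (A B C : 'M[F]_3)
    (e e' v w : 'rV_3) :
    irreducible_poly (cubic a b c) ->
    horner_mx A (cubic a b c) = 0 -> horner_mx B (cubic a b c) = 0 ->
    horner_mx C (cubic a b c) = 0 -> A != B -> A != C ->
    e != 0 -> e' != 0 -> e *m A = e *m B -> e' *m A = e' *m C ->
    row_mx v w != 0 ->
    v *m (B - A) + w *m (B ^+ 2 - A ^+ 2) = 0 ->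
    v *m (C - A) + w *m (C ^+ 2 - A ^+ 2) = 0 ->
  exists2 t : F, t != 0 & e' = t *: e.
Proof.
move=> m_irr A0 B0 C0 neqAB neqAC e0 e'0 eAB e'AC vw0 vwB vwC.
have [x [y [z [vE wE]]]] := diff_col_kernel m_irr A0 B0 neqAB e0 eAB vwB.
have [x' [y' [z' [vE' wE']]]] := diff_col_kernel m_irr A0 C0 neqAC e'0 e'AC vwC.
(* Polynomials whose values at [A] send e to v and to w; with primed coefficients they send e' to
   the same rows. *)
pose lin (x y : F) : {poly F} := x%:P - y%:P * 'X.
pose aff (y z : F) : {poly F} := y%:P + z%:P * ('X + a%:P).
have linE (f : 'rV_3) s t : f *m horner_mx A (lin s t) = s *: f - t *: (f *m A).
  rewrite rmorphB rmorphM /= !horner_mx_C horner_mx_X mulmxBr -mulmxE mulmxA.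
  by rewrite !mul_mx_scalar -scalemxAl.
have affE (f : 'rV_3) s t :
    f *m horner_mx A (aff s t) = s *: f + t *: (f *m A + a *: f).
  rewrite rmorphD rmorphM rmorphD /= !horner_mx_C horner_mx_X mulmxDr -mulmxE.
  by rewrite mulmxA !mul_mx_scalar -scalemxAl mulmxDr mul_mx_scalar.
(* Polynomials in [A] commute, so both products send e to the row that [lin x' y' * aff y' z'] makes
   of e'. *)
have cross : e *m horner_mx A (lin x y * aff y' z' - lin x' y' * aff y z) = 0.
  rewrite rmorphB mulmxBr (mulrC (lin x' y')) !rmorphM /= -!mulmxE !mulmxA.
  rewrite (linE e) (affE e) -vE -wE vE' wE' -linE -affE -!mulmxA.
  by rewrite !mulmxE -!rmorphM mulrC subrr.
have [E0 E1 E2] : [/\ x * (y' + a * z') - x' * (y + a * z) = 0,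
    x * z' - y * (y' + a * z') - (x' * z - y' * (y + a * z)) = 0
  & y' * z - y * z' = 0].
  apply: (cubic_coords_eq0 m_irr A0 e0); rewrite -mul_horner_quadratic -cross.
  by congr (e *m horner_mx A _); rewrite /lin /aff; ring.
(* The system is triangular: the minor from degree 2 clears the [a] terms of [E1], and the resulting
   minor clears those of [E0]. *)
have yz : y * z' = y' * z by apply/esym/subr0_eq.
have xz : x * z' = x' * z.
  by apply/subr0_eq; rewrite -E1; ring: yz.
have xy : x * y' = x' * y.
  by apply/subr0_eq; rewrite -E0; ring: xz.
have [|t [xt yt zt]] := proportional3 xy xz yz.
  case=> x'0 y'0 z'0; case/eqP: vw0; rewrite vE' wE' x'0 y'0 z'0.
  by rewrite !scale0r subr0 addr0 row_mx0.
suff e't : e' = t *: e.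
  by exists t => //; apply: contraNneq e'0 => t0; rewrite e't t0 scale0r.
(* The row f = e' - te is killed by both primed polynomials; were it nonzero, all primed
   coefficients would vanish, and v and w with them. *)
apply/eqP; rewrite -subr_eq0; apply/negPn/negP => f0; case/eqP: vw0.
have [|x'0 y'0] := @lin_coords_eq0 _ _ _ _ x' y' _ _ m_irr A0 f0.
  rewrite -linE mulmxBl -scalemxAl !linE -vE' vE xt yt.
  by rewrite (scalerBr t) !scalerA subrr.
have [|_ z'0] := @affine_coords_eq0 _ _ _ _ y' z' _ _ m_irr A0 f0.
  rewrite -affE mulmxBl -scalemxAl !affE -wE' wE yt zt.
  by rewrite (scalerDr t) !scalerA subrr.
by rewrite vE' wE' x'0 y'0 z'0 !scale0r subr0 addr0 row_mx0.
Qed.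

(** * The cycle of implications *)

Theorem theorem3p10 (F : fieldType) (a b c : F) (m : {poly F})
    (m_def : m = 'X^3 + a *: 'X^2 + b *: 'X + c%:P)
    (m_irr : irreducible_poly m)
    (A B C : 'M[F]_3)
    (A_m : A \in minpoly_class m)
    (B_m : B \in minpoly_class m)
    (C_m : C \in minpoly_class m)
    (neqAB : A != B) (neqAC : A != C) (neqBC : B != C)
    (BA_singular : B - A \notin unitmx)
    (CA_singular : C - A \notin unitmx) :
  [<-> block_vandermonde3 A B C \notin unitmx;
       vandermonde_diff2 A B C \notin unitmx;
       (null_sum A B == null_sum A C)%MS;
       (kermx (B - A)%R == kermx (C - A)%R)%MS;
       exists v : 'rV[F]_3, [/\ v != 0, v *m A = v *m B & v *m B = v *m C]].
Proof.
have cubicE : m = cubic a b c by [].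
rewrite {}cubicE {m_def} in m_irr A_m B_m C_m.
have root (X : 'M_3) : X \in minpoly_class (cubic a b c) ->
    horner_mx X (cubic a b c) = 0.
  by move/eqP=> <-; exact: mx_root_minpoly.
have A0 := root _ A_m; have B0 := root _ B_m; have C0 := root _ C_m.
have fixed_row (X : 'M_3) : X - A \notin unitmx ->
    exists2 e : 'rV_3, e != 0 & e *m A = e *m X.
  case/singular_row_kernel=> e e0; rewrite mulmxBr => /eqP.
  by rewrite subr_eq0 => /eqP eXA; exists e.
have [e e0 eAB] := fixed_row _ BA_singular.
have [e' e'0 e'AC] := fixed_row _ CA_singular.
have kerB := kermx_diff m_irr A0 B0 neqAB e0 eAB.
have kerC := kermx_diff m_irr A0 C0 neqAC e'0 e'AC.
have sumB := null_sum_span m_irr A0 B0 neqAB e0 eAB.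
have sumC := null_sum_span m_irr A0 C0 neqAC e'0 e'AC.
tfae.
(* The block columns say u + vX + wX^2 = 0 for X = A, B, C. Subtracting the equation for A
   eliminates u, and v = w = 0 would give u = 0. *)
- case/singular_row_kernel => u; rewrite -[u]hsubmxK -[rsubmx u]hsubmxK.
  move: (lsubmx u) (lsubmx (rsubmx u)) (rsubmx (rsubmx u)) => {}u v w uvw0.
  rewrite !mul_row_col !mul_mx_row !mulmx1 !add_row_mx => /eqP.
  rewrite !row_mx_eq0 => /and3P[/eqP uA /eqP uB /eqP uC].
  apply/singular_row_kernel; exists (row_mx v w).
    apply: contraNneq uvw0 => vw0; move: uA; move/eqP: vw0; rewrite row_mx_eq0.
    case/andP=> /eqP-> /eqP->; rewrite !mul0mx !addr0 => ->.
    by rewrite !row_mx0.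
  rewrite mul_row_block !mulmxBr; apply/eqP; rewrite row_mx_eq0.
  rewrite addrACA -opprD [X in _ && (X == 0)]addrACA -opprD !subr_eq0.
  by rewrite -(addr0_eq uA) -(addr0_eq uB) -(addr0_eq uC) eqxx.
- case/singular_row_kernel => u; rewrite -[u]hsubmxK.
  rewrite mul_row_block => vw0 /eqP; rewrite row_mx_eq0.
  case/andP=> /eqP vwB /eqP vwC.
  have [t t0 e't] := kernels_parallel m_irr A0 B0 C0 neqAB neqAC e0 e'0 eAB
    e'AC vw0 vwB vwC.
  apply/eqmxP; apply: eqmx_trans sumB _; apply: eqmx_trans _ (eqmx_sym sumC).
  rewrite e't -scalemxAl.
  by apply/eqmx_sym/adds_eqmx; exact: eqmx_scale.
- move/eqmxP=> eq_sum.
  have [||t e't] := @span_shift_parallel _ _ _ _ _ _ e' m_irr A0 e0.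
  + by rewrite -sumB eq_sum sumC addsmxSl.
  + by rewrite -sumB eq_sum sumC addsmxSr.
  have t0 : t != 0 by apply: contraNneq e'0 => t0; rewrite e't t0 scale0r.
  apply/eqmxP; apply: eqmx_trans kerB _; apply: eqmx_trans _ (eqmx_sym kerC).
  by rewrite e't; apply/eqmx_sym; exact: eqmx_scale.
- move/eqmxP=> eq_ker; exists e; split=> //; rewrite -eAB; apply/esym/eqP.
  have : (e <= kermx (C - A)%R)%MS by rewrite -eq_ker kerB.
  by move/sub_kermxP; rewrite mulmxBr => /eqP; rewrite subr_eq0.
- case=> v [v0 vAB vBC]; apply/singular_row_kernel.
  (* The block columns of the product are -vA + vX for X = A, B, C. *)
  exists (row_mx (- (v *m A)) (row_mx v 0)).
    by rewrite !row_mx_eq0 (negPf v0) andbF.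
  rewrite !mul_row_col !mul_mx_row !mulmx1 !mul0mx !add_row_mx !addr0 -vBC -vAB.
  by rewrite addNr !row_mx0.
Qed.
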